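(* Let $\mathbb{K}$ be a field and let $G$ be a finite simple graph with $n$ vertices. Then $${\rm reg}(J(G))\leq n-\alpha_2(G),$$ where $J(G)$ is the cover ideal of $G$ and $\alpha_2(G)$ is the star packing number of $G$.
   Context: Let $V(G)=\{x_1,\ldots,x_n\}$, $S=\mathbb{K}[x_1,\ldots,x_n]$. The cover ideal of $G$ is $J(G)=\bigcap_{x_ix_j\in E(G)}(x_i,x_j)\subseteq S$ (so $J(G)=S$ if $G$ has no edges). For a graded $S$-module $M$ with graded Betti numbers $\beta_{i,j}(M)$, the Castelnuovo-Mumford regularity is ${\rm reg}(M)=\max\{j-i\mid \beta_{i,j}(M)\neq 0\}$; here ${\rm reg}(J(G))$ is the regularity of $J(G)$ as an $S$-module (not of $S/J(G)$). For a vertex $x$, $N_G[x]=N_G(x)\cup\{x\}$ is its closed neighborhood. The star ${\rm St}(x)$ with center $x$ is the subgraph with vertex set $N_G[x]$ and edge set $\{xy\mid y\in N_G(x)\}$. A star packing of $G$ is a family of stars ${\rm St}(x)$ (with distinct centers) whose vertex sets $N_G[x]$ are pairwise disjoint. The star packing number $\alpha_2(G)$ is the maximum cardinality of a star packing of $G$. *)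

(* Defs.v *)
From mathcomp Require Import all_boot all_order all_algebra.
From mathcomp Require Export mpoly.

Set Implicit Arguments.
Unset Strict Implicit.
Unset Printing Implicit Defensive.

Import GRing.Theory Num.Theory.
Local Open Scope ring_scope.

(* A simple graph on the vertices x_0, ..., x_(n-1) is a symmetric irreflexive
   relation on 'I_n. *)
Section Graph.
Variables (n : nat) (adj : rel 'I_n).

Definition closed_nbhd (x : 'I_n) : {set 'I_n} := [set y | (y == x) || adj x y].

(* St(x) is determined by its center x, so a star packing, whose stars have
   distinct centers, is encoded by its set of centers. *)
Definition star_packing (C : {set 'I_n}) : bool :=
  [forall x in C, forall y in C,
     (x != y) ==> [disjoint closed_nbhd x & closed_nbhd y]].

Definition star_packing_number : nat :=
  \max_(C : {set 'I_n} | star_packing C) #|C|.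

Definition cover_ideal (K : fieldType) (f : {mpoly K[n]}) : Prop :=
  forall i j : 'I_n, adj i j ->
    exists a b : {mpoly K[n]}, f = a * 'X_i + b * 'X_j.

End Graph.

Section Resolution.
Variables (K : fieldType) (n : nat).
Local Notation S := {mpoly K[n]}.

(* f lies in the graded piece S_z, which is 0 for z < 0. *)
Definition in_degree (z : int) (f : S) : Prop :=
  {in msupp f, forall m, (mdeg m)%:Z = z}.

(* Free modules
     ... -> F_2 -> F_1 -> F_0 -> S,   F_i = \bigoplus_p S(- gen_deg i p),
   of finite rank, together with maps between them. Elements of F_i are row
   vectors and the maps F_(i+1) -> F_i and F_0 -> S are right multiplication by
   diff i and aug. *)
Record free_complex := FreeComplex {
  free_rank : nat -> nat;
  gen_deg : forall i, 'I_(free_rank i) -> int;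
  diff : forall i, 'M[S]_(free_rank i.+1, free_rank i);
  aug : 'cV[S]_(free_rank 0)
}.

(* All maps are homogeneous of degree 0. *)
Definition graded_complex (F : free_complex) : Prop :=
  (forall p, in_degree (gen_deg p) (aug F p 0)) /\
  (forall i p q, in_degree (gen_deg p - gen_deg q) (diff F i p q)).

(* Exactness of ... -> F_1 -> F_0 -> I -> 0. *)
Definition resolves (F : free_complex) (I : S -> Prop) : Prop :=
  [/\ forall f : S, I f <-> exists v : 'rV[S]_(free_rank F 0),
        (v *m aug F) 0 0 = f,
      forall v : 'rV[S]_(free_rank F 0),
        v *m aug F = 0 <-> exists u, v = u *m diff F 0 &
      forall i (v : 'rV[S]_(free_rank F i.+1)),
        v *m diff F i = 0 <-> exists u, v = u *m diff F i.+1].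

(* The image of F_(i+1) lies in (x_0, ..., x_(n-1)) F_i: the entries of the
   matrices have no constant term. *)
Definition minimal_complex (F : free_complex) : Prop :=
  forall i p q, (diff F i p q)@_0%MM = 0.

Definition minimal_graded_free_resolution (F : free_complex) (I : S -> Prop) :=
  [/\ graded_complex F, resolves F I & minimal_complex F].

(* The number of copies of S(-j) in F_i. *)
Definition shift_multiplicity (F : free_complex) (i : nat) (j : int) : nat :=
  #|[set p : 'I_(free_rank F i) | gen_deg p == j]|.

(* beta i j is the graded Betti number beta_(i,j)(I) of the S-module I; minimal
   graded free resolutions are unique up to isomorphism, so beta is unique. *)
Definition is_graded_betti (I : S -> Prop) (beta : nat -> int -> nat) : Prop :=
  exists F, minimal_graded_free_resolution F I /\
    forall i j, beta i j = shift_multiplicity F i j.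

(* r = reg(I) = max {j - i | beta_(i,j)(I) <> 0}. *)
Definition is_regularity (I : S -> Prop) (r : int) : Prop :=
  exists beta, [/\ is_graded_betti I beta,
    exists i j, beta i j <> 0%N /\ r = j - i%:Z &
    forall i j, beta i j <> 0%N -> j - i%:Z <= r].

End Resolution.

(* Main.v *)
Require Import Defs.
From mathcomp Require Import all_boot all_order all_algebra.
From mathcomp Require Import zify ring.
Local Open Scope ring_scope.

(** The bound comes from one exact sequence. Let [G] be the graph induced on a
    vertex set [W], let [x] be a vertex of [W], [N] its set of neighbours in
    [W], and write [x^N] for the product of the variables in [N]. A vertex
    cover of [G] contains [x] or contains [N], so
      [J(G) = x J(G - x) + x^N J(G - N[x])],
    and the two summands meet in [x x^N J(G - N[x])]. This gives
      [0 -> J(G - N[x])(-|N| - 1) -> J(G - x)(-1) (+) J(G - N[x])(-|N|)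
         -> J(G) -> 0],
    hence
      [reg J(G) <= max (reg J(G - x) + 1, reg J(G - N[x]) + |N|)].

    Given a star packing with set of centers [C], take [x] in [W] but not in
    [C]. Then [C] is still a packing of [G - x]. Since the closed
    neighbourhoods of the centers are disjoint, at most one center is adjacent
    to [x], so [C] minus [N[x]] is a packing of [G - N[x]] with at least
    [|C| - 1] centers. By induction on [|W|] both terms of the maximum are at
    most [|W| - |C|] ([ideal_reg_le_packing]). If there is no such [x], every
    vertex is a center, the graph has no edge and [J(G)] is the whole ring,
    of regularity [0 = |W| - |C|].

    To speak of the regularity of these ideals without constructing their
    resolutions, [reg_le k r d M] says that [M] has homogeneous generators of
    degree at most [r], whose syzygies have generators of degree at most
    [r + 1], and so on for [k] steps. This behaves well in short exact
    sequences ([reg_le_ext], [reg_le_coker]), and by a Schanuel argument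
    ([reg_le_syzygies]) the bound passes to the syzygies of any other choice
    of generators in degrees at most [r]. Applied step by step to a minimal
    resolution, whose generators cannot exceed the degrees of an arbitrary
    generating set ([minimal_gen_deg]), this bounds all shifts
    ([minimal_resolution_deg]). *)

Set Implicit Arguments.
Unset Strict Implicit.
Unset Printing Implicit Defensive.

Import Order.TTheory GRing.Theory Num.Theory.

Section Regularity.
Variables (K : fieldType) (n : nat).
Local Notation S := {mpoly K[n]}.

(** * Homogeneous components *)

Definition mono_part (P : pred 'X_{1..n}) (f : S) : S :=
  \sum_(m <- msupp f | P m) f@_m *: 'X_[m].

Lemma mcoeff_mono_part P f m :
  (mono_part P f)@_m = if P m then f@_m else 0.
Proof.
rewrite /mono_part raddf_sum /= big_mkcond /=.
have [mf|mf] := boolP (m \in msupp f).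
  rewrite (bigD1_seq m) ?msupp_uniq //= big1 => [|k /negbTE km].
    by rewrite addr0 mcoeffZ mcoeffX eqxx mulr1.
  by rewrite mcoeffZ mcoeffX km mulr0 if_same.
rewrite big1_seq => [|k /andP[_ kf]].
  by rewrite memN_msupp_eq0 ?if_same.
rewrite mcoeffZ mcoeffX; case: eqP => [km|_]; last by rewrite mulr0 if_same.
by rewrite -km kf in mf.
Qed.

Definition homog_part (z : int) : S -> S :=
  mono_part (fun m => (mdeg m)%:Z == z).

Lemma mcoeff_homog_part z f m :
  (homog_part z f)@_m = if (mdeg m)%:Z == z then f@_m else 0.
Proof. exact: mcoeff_mono_part. Qed.

Lemma homog_part_in_degree z f : in_degree z (homog_part z f).
Proof.
move=> m; rewrite mcoeff_msupp mcoeff_homog_part.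
by case: ifP => [/eqP //|_]; rewrite eqxx.
Qed.

Lemma homog_part_id z f : in_degree z f -> homog_part z f = f.
Proof.
move=> fz; apply/mpolyP => m; rewrite mcoeff_homog_part.
by have [/fz ->|/memN_msupp_eq0 ->] := boolP (m \in msupp f);
  rewrite ?eqxx ?if_same.
Qed.

Lemma homog_part_sum z (I : finType) (F : I -> S) :
  homog_part z (\sum_i F i) = \sum_i homog_part z (F i).
Proof.
apply/mpolyP => m; rewrite mcoeff_homog_part [in RHS]raddf_sum.
case: ifP => mz; last by rewrite big1 // => i _; rewrite [LHS]mcoeff_homog_part mz.
by rewrite raddf_sum; apply: eq_bigr => i _; rewrite [RHS]mcoeff_homog_part mz.
Qed.

(** Multiplication by a form of degree [e] shifts homogeneous components by
    [e], because in each product of monomials contributing to [f * g] the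
    second factor has degree [e]. *)
Lemma homog_part_mulr z e f g :
  in_degree e g -> homog_part z (f * g) = homog_part (z - e) f * g.
Proof.
move=> ge; apply/mpolyP => m; rewrite mcoeff_homog_part !mcoeffM.
rewrite [LHS](_ : _ = \sum_(k : 'X_{1..n < (mdeg m).+1, (mdeg m).+1} | m == (k.1 + k.2)%MM)
   if (mdeg m)%:Z == z then f@_k.1 * g@_k.2 else 0); last first.
  by case: ifP => // _; rewrite big1.
apply: eq_bigr => k /eqP mk; rewrite mcoeff_homog_part.
have {}mk : mdeg m = (mdeg k.1 + mdeg k.2)%N by rewrite -mdegD; congr mdeg.
have [/ge k2|/memN_msupp_eq0 ->] := boolP (bmnm k.2 \in msupp g); last first.
  by rewrite !mulr0 if_same.
have -> : ((mdeg m)%:Z == z) = ((mdeg k.1)%:Z == z - e) by lia.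
by case: ifP; rewrite ?mul0r.
Qed.

Lemma in_degree0 z : in_degree z (0 : S).
Proof. by move=> m; rewrite msupp0. Qed.

Lemma in_degreeN z (f : S) : in_degree z f -> in_degree z (- f).
Proof. by move=> fz m; rewrite (perm_mem (msuppN f)); apply: fz. Qed.

(** * Graded submodules of free modules *)

(** Matrices act on row vectors from the right, so [A] sends the basis element
    of degree [e i] to its [i]-th row; [graded_mx] makes this map homogeneous
    of degree 0. *)
Definition graded_mx p m (e : 'I_p -> int) (d : 'I_m -> int) (A : 'M[S]_(p, m)) :=
  forall i j, in_degree (e i - d j) (A i j).

Definition homog_row m (d : 'I_m -> int) (z : int) (v : 'rV[S]_m) : 'rV[S]_m :=
  \row_j homog_part (z - d j) (v 0 j).

Lemma homog_row_mulmx p m (e : 'I_p -> int) (d : 'I_m -> int) (A : 'M[S]_(p, m)) z v :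
  graded_mx e d A -> homog_row d z (v *m A) = homog_row e z v *m A.
Proof.
move=> gA; apply/rowP => j; rewrite !mxE homog_part_sum; apply: eq_bigr => i _.
by rewrite (homog_part_mulr _ _ (gA i j)) mxE; congr (homog_part _ _ * _); ring.
Qed.

Lemma homog_row_row p m (e : 'I_p -> int) (d : 'I_m -> int) (A : 'M[S]_(p, m)) i :
  graded_mx e d A -> homog_row d (e i) (row i A) = row i A.
Proof. by move=> gA; apply/rowP => j; rewrite !mxE homog_part_id. Qed.

Definition graded_submod m (d : 'I_m -> int) (M : 'rV[S]_m -> Prop) : Prop :=
  [/\ M 0, forall u v, M u -> M v -> M (u + v), forall a u, M u -> M (a *: u)
    & forall z u, M u -> M (homog_row d z u)].

Lemma homog_row0 m (d : 'I_m -> int) z : homog_row d z 0 = 0.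
Proof. by apply/rowP => j; rewrite !mxE homog_part_id //; apply: in_degree0. Qed.

Lemma graded_submod_ker p m (e : 'I_p -> int) (d : 'I_m -> int) (A : 'M[S]_(p, m)) :
  graded_mx e d A -> graded_submod e (fun u => u *m A = 0).
Proof.
move=> gA; split=> [|u v uA vA|a u uA|z u uA]; first exact: mul0mx.
- by rewrite mulmxDl uA vA addr0.
- by rewrite -scalemxAl uA scaler0.
- by rewrite -(homog_row_mulmx _ _ gA) uA homog_row0.
Qed.

Lemma graded_submod_mulmx m q (d : 'I_m -> int) M (w : 'rV[S]_q) (L : 'M[S]_(q, m)) :
  graded_submod d M -> (forall i, M (row i L)) -> M (w *m L).
Proof.
case=> M0 MD MZ _ ML; rewrite mulmx_sum_row.
by elim/big_ind: _ => // i _; apply: MZ.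
Qed.

(** Homogeneous elements of the image of a graded module have homogeneous
    preimages: take the component of the right degree of any preimage. *)
Lemma graded_lift m c q (d : 'I_m -> int) (d' : 'I_c -> int) (f : 'I_q -> int)
    (M : 'rV[S]_m -> Prop) (phi : 'M[S]_(m, c)) (B : 'M[S]_(q, c)) :
  graded_submod d M -> graded_mx d d' phi -> graded_mx f d' B ->
  (forall i, exists2 v, M v & v *m phi = row i B) ->
  exists L : 'M[S]_(q, m),
    [/\ graded_mx f d L, forall i, M (row i L) & L *m phi = B].
Proof.
move=> [_ _ _ Mz] gphi gB liftB.
have [v vP] : exists v : 'I_q -> 'rV[S]_m, forall i, M (v i) /\ v i *m phi = row i B.
  apply: (fin_all_exists (P := fun i (v : 'rV_m) => M v /\ v *m phi = row i B)) => i.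
  by have [v Mv vB] := liftB i; exists v.
exists (\matrix_i homog_row d (f i) (v i)); split.
- by move=> i j; rewrite !mxE; exact: homog_part_in_degree.
- by move=> i; rewrite rowK; apply: Mz; case: (vP i).
- apply/row_matrixP => i; rewrite row_mul rowK -(homog_row_mulmx _ _ gphi).
  by rewrite (proj2 (vP i)) homog_row_row.
Qed.

Definition sum_deg p q (e : 'I_p -> int) (f : 'I_q -> int) (i : 'I_(p + q)) : int :=
  match split i with inl i => e i | inr j => f j end.

Lemma graded_col_mx p q m (e : 'I_p -> int) (f : 'I_q -> int) (d : 'I_m -> int)
    (A : 'M[S]_(p, m)) (B : 'M[S]_(q, m)) :
  graded_mx e d A -> graded_mx f d B -> graded_mx (sum_deg e f) d (col_mx A B).
Proof. by move=> gA gB i j; rewrite mxE /sum_deg; case: split. Qed.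

Lemma graded_row_mx m p q (d : 'I_m -> int) (e : 'I_p -> int) (f : 'I_q -> int)
    (A : 'M[S]_(m, p)) (B : 'M[S]_(m, q)) :
  graded_mx d e A -> graded_mx d f B -> graded_mx d (sum_deg e f) (row_mx A B).
Proof. by move=> gA gB i j; rewrite mxE /sum_deg; case: split. Qed.

Lemma graded_mx0 p m (e : 'I_p -> int) (d : 'I_m -> int) :
  graded_mx e d (0 : 'M[S]_(p, m)).
Proof. by move=> i j; rewrite mxE; apply: in_degree0. Qed.

Lemma graded_mx1 p (e : 'I_p -> int) : graded_mx e e (1%:M : 'M[S]_p).
Proof.
move=> i j; rewrite mxE; case: (i =P j) => [<-|_]; last exact: in_degree0.
move=> m; rewrite mcoeff_msupp mcoeff1 subrr.
by case: (m =P 0%MM) => [->|]; rewrite ?mdeg0 ?eqxx.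
Qed.

Lemma graded_mxN p m (e : 'I_p -> int) (d : 'I_m -> int) (A : 'M[S]_(p, m)) :
  graded_mx e d A -> graded_mx e d (- A).
Proof. by move=> gA i j; rewrite mxE; apply: in_degreeN. Qed.

Lemma graded_mulmx p m c (e : 'I_p -> int) (d : 'I_m -> int) (d' : 'I_c -> int)
    (A : 'M[S]_(p, m)) (B : 'M[S]_(m, c)) :
  graded_mx e d A -> graded_mx d d' B -> graded_mx e d' (A *m B).
Proof.
move=> gA gB i j; have -> : (A *m B) i j = homog_row d' (e i) (row i (A *m B)) 0 j.
  by rewrite row_mul (homog_row_mulmx _ _ gB) (homog_row_row _ gA) -row_mul [RHS]mxE.
by rewrite mxE; exact: homog_part_in_degree.
Qed.

(** * Regularity without a chosen resolution *)

(** The recursion runs through syzygy modules, so that [reg_le k r d M] for all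
    [k] is the statement that [M] has regularity at most [r]. Truncating at [k]
    steps makes inductive proofs possible without choosing an infinite
    resolution. Modules are given as submodules of a free module with basis in
    degrees [d]. *)
Fixpoint reg_le (k : nat) (r : int) m (d : 'I_m -> int) (M : 'rV[S]_m -> Prop) : Prop :=
  if k is k'.+1 then
    exists p (e : 'I_p -> int) (A : 'M[S]_(p, m)),
      [/\ graded_mx e d A, forall i, e i <= r,
          forall v, M v <-> exists u, v = u *m A
        & reg_le k' (r + 1) e (fun u => u *m A = 0)]
  else True.

Lemma reg_le_eq k r m (d : 'I_m -> int) (M M' : 'rV[S]_m -> Prop) :
  (forall v, M v <-> M' v) -> reg_le k r d M -> reg_le k r d M'.
Proof.
move=> MM'; case: k => //= k [p [e [A [gA er MA kA]]]]; exists p, e, A.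
by split=> // v; rewrite -MM'.
Qed.

Lemma reg_le_mono k r s m (d : 'I_m -> int) (M : 'rV[S]_m -> Prop) :
  r <= s -> reg_le k r d M -> reg_le k s d M.
Proof.
elim: k r s m d M => //= k IHk r s m d M rs [p [e [A [gA er MA kA]]]].
exists p, e, A; split=> // [i|]; first exact: le_trans (er i) rs.
by apply: IHk kA; rewrite lerD2r.
Qed.

Lemma reg_le_trunc k r m (d : 'I_m -> int) (M : 'rV[S]_m -> Prop) :
  reg_le k.+1 r d M -> reg_le k r d M.
Proof.
elim: k r m d M => // k IHk r m d M [p [e [A [gA er MA /IHk kA]]]].
by exists p, e, A.
Qed.

(** This is the twist [M(-s)]: the same vectors, with all degrees raised. *)
Lemma reg_le_twist k r s m (d : 'I_m -> int) (M : 'rV[S]_m -> Prop) :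
  reg_le k (r - s) d M -> reg_le k r (fun i => d i + s) M.
Proof.
elim: k r m d M => //= k IHk r m d M [p [e [A [gA er MA kA]]]].
exists p, (fun i => e i + s), A; split=> // [i j|i|].
- by have := gA i j; congr in_degree; ring.
- by rewrite -lerBrDr.
- by apply: IHk; rewrite -addrA (addrC 1) addrA.
Qed.

Lemma reg_le_zero k r m (d : 'I_m -> int) : reg_le k r d (fun v => v = 0).
Proof.
elim: k r m d => //= k IHk r m d; exists 0%N, (fun=> 0), 0; split.
- by case.
- by case.
- by move=> v; split=> [->|[u ->]]; [exists 0|]; rewrite mulmx0.
- by apply: reg_le_eq (IHk _ _ _) => v; split=> _; [rewrite mulmx0|apply/rowP; case].
Qed.

Lemma reg_le_free k r m (d : 'I_m -> int) :
  (forall i, d i <= r) -> reg_le k r d (fun=> True).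
Proof.
case: k => //= k dr; exists m, d, 1%:M; split=> //.
- exact: graded_mx1.
- by move=> v; split=> // _; exists v; rewrite mulmx1.
- by apply: reg_le_eq (reg_le_zero _ _ _) => v; rewrite mulmx1.
Qed.

(** An injective homogeneous map transports [reg_le], since generators and
    their images have the same syzygies. This is how isomorphic modules in
    different free modules are compared. *)
Lemma reg_le_inj k r m c (d : 'I_m -> int) (d' : 'I_c -> int) phi
    (M : 'rV[S]_m -> Prop) (M' : 'rV[S]_c -> Prop) :
  graded_mx d d' phi -> (forall v, M v -> v *m phi = 0 -> v = 0) ->
  (forall w, M' w <-> exists2 v, M v & w = v *m phi) ->
  reg_le k r d M -> reg_le k r d' M'.
Proof.
case: k => //= k gphi inj M'P [p [e [A [gA er MA kA]]]].
exists p, e, (A *m phi); split=> //.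
- exact: graded_mulmx gA gphi.
- move=> w; rewrite M'P; split=> [[v /MA[u ->] ->]|[u ->]].
    by exists u; rewrite mulmxA.
  by exists (u *m A); rewrite ?mulmxA //; apply/MA; exists u.
- apply: reg_le_eq kA => u; rewrite mulmxA; split=> [->|]; first exact: mul0mx.
  by apply: inj; apply/MA; exists u.
Qed.

(** The horseshoe argument: generators of the kernel, together with lifts [L] of
    generators of the image, generate [M], and the syzygies of this family are
    an extension of the syzygies of the image by those of the kernel. *)
Lemma reg_le_ext k r m c (d : 'I_m -> int) (d' : 'I_c -> int) phi (M : 'rV[S]_m -> Prop) :
  graded_submod d M -> graded_mx d d' phi ->
  reg_le k r d (fun v => M v /\ v *m phi = 0) ->
  reg_le k r d' (fun w => exists2 v, M v & w = v *m phi) ->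
  reg_le k r d M.
Proof.
elim: k r m c d d' phi M => // k IHk r m c d d' phi M gM gphi.
case=> p [e [A [gA er MA kA]]] [q [f [B [gB fr MB kB]]]].
have [i|L [gL ML Lphi]] := graded_lift gM gphi gB.
  have [|v Mv vB] := (MB (row i B)).2; last by exists v.
  by exists (delta_mx 0 i); rewrite -rowE.
have MuA u : M (u *m A) by have [|] := (MA (u *m A)).2; first by exists u.
have uAphi (u : 'rV_p) : u *m A *m phi = 0 by have [|] := (MA (u *m A)).2; first by exists u.
have MwL w : M (w *m L) by apply: graded_submod_mulmx gM ML.
have [M0 MD MZ _] := gM.
exists (p + q)%N, (sum_deg e f), (col_mx A L); split.
- exact: graded_col_mx.
- by move=> i; rewrite /sum_deg; case: split.
- move=> v; split=> [Mv|[u ->]]; last by rewrite -[u]hsubmxK mul_row_col; apply: MD.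
  have [|w vphi] := (MB (v *m phi)).1; first by exists v.
  have [|u vA] := (MA (v - w *m L)).1.
    rewrite mulmxBl -mulmxA Lphi vphi subrr; split=> //.
    by rewrite -scaleN1r; apply: MD => //; apply: MZ.
  by exists (row_mx u w); rewrite mul_row_col -vA subrK.
- pose pr : 'M[S]_(p + q, q) := col_mx 0 1%:M.
  apply: (IHk _ _ _ _ f pr).
  + exact/graded_submod_ker/graded_col_mx.
  + by apply: graded_col_mx; [apply: graded_mx0|apply: graded_mx1].
  + apply: (@reg_le_inj k _ _ _ e _ (row_mx 1%:M 0)) kA => [|u _|u].
    * by apply: graded_row_mx; [apply: graded_mx1|apply: graded_mx0].
    * by rewrite mul_mx_row mulmx1 mulmx0 -row_mx0 => /eq_row_mx[].
    * rewrite -[u]hsubmxK !mul_row_col mulmx0 add0r mulmx1.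
      split=> [[]|[v vA]]; last first.
        rewrite mul_mx_row mulmx1 mulmx0 => /eq_row_mx[-> ->].
        by rewrite vA mul0mx addr0.
      move=> uA u0; move: uA; rewrite u0 mul0mx addr0 => uA; exists (lsubmx u) => //.
      by rewrite mul_mx_row mulmx1 mulmx0.
  + apply: reg_le_eq kB => w; split=> [wB|[u + ->]]; last first.
      rewrite -[u]hsubmxK !mul_row_col mulmx0 add0r mulmx1 -Lphi mulmxA => /eqP.
      by rewrite addrC addr_eq0 => /eqP ->; rewrite mulNmx uAphi oppr0.
    have [|u wLA] := (MA (w *m L)).1; first by rewrite -mulmxA Lphi.
    exists (row_mx (- u) w); rewrite mul_row_col.
      by rewrite mulNmx -wLA addNr.
    by rewrite mulmx0 add0r mulmx1.
Qed.

(** If [A] generates [M], the syzygies of the images of its rows are an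
    extension of the kernel of [phi] on [M] by the syzygies of [A]. The kernel
    thus contributes to the syzygies, where degrees up to [r + 1] are
    allowed. *)
Lemma reg_le_coker k r m c (d : 'I_m -> int) (d' : 'I_c -> int) phi
    (M : 'rV[S]_m -> Prop) :
  graded_mx d d' phi ->
  reg_le k (r + 1) d (fun v => M v /\ v *m phi = 0) ->
  reg_le k r d M ->
  reg_le k r d' (fun w => exists2 v, M v & w = v *m phi).
Proof.
case: k => // k gphi /reg_le_trunc kphi [p [e [A [gA er MA kA]]]].
have MuA u : M (u *m A) by apply/MA; exists u.
exists p, e, (A *m phi); split=> //.
- exact: graded_mulmx gA gphi.
- move=> w; split=> [[v /MA[u ->] ->]|[u ->]]; first by exists u; rewrite mulmxA.
  by exists (u *m A); rewrite ?mulmxA.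
- apply: (reg_le_ext (graded_submod_ker (graded_mulmx gA gphi)) gA).
    apply: reg_le_eq kA => u; split=> [uA|[]//].
    by rewrite mulmxA uA mul0mx.
  apply: reg_le_eq kphi => v; split=> [[/MA[u ->] uphi]|[u uphi ->]].
    by exists u; rewrite ?mulmxA.
  by rewrite -mulmxA.
Qed.

(** * Minimal resolutions *)

(** Schanuel's lemma. Let [B] be the generators provided by [reg_le] and [P] the
    pullback of [A] and [B], made of the pairs [(u, w)] with [u A = w B].
    Projecting to [u] shows that [P] is an extension of a free module by the
    syzygies of [B]. Writing [B = V A], the map [(u, w) |-> u - w V] sends [P]
    onto the syzygies of [A], with a free kernel. *)
Lemma reg_le_syzygies k r p m (e : 'I_p -> int) (d : 'I_m -> int) (A : 'M[S]_(p, m)) :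
  graded_mx e d A -> (forall i, e i <= r) ->
  reg_le k.+1 r d (fun v => exists u, v = u *m A) ->
  reg_le k (r + 1) e (fun u => u *m A = 0).
Proof.
move=> gA er [q [f [B [gB fr AB kB]]]].
have gT l (g : 'I_l -> int) : graded_submod g (fun=> True) by split.
have [i|V [gV _ VA]] := graded_lift (gT _ e) gA gB.
  have [|u ->] := (AB (row i B)).2; last by exists u.
  by exists (delta_mx 0 i); rewrite -rowE.
(* The sign turns the pullback into the kernel of one graded matrix. *)
pose P (x : 'rV[S]_(p + q)) := x *m col_mx A (- B) = 0.
have gAB : graded_mx (sum_deg e f) d (col_mx A (- B)).
  exact/graded_col_mx/graded_mxN.
have r1 s : s <= r -> s <= r + 1 by move=> ?; lia.
have kP : reg_le k (r + 1) (sum_deg e f) P.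
  have gpr : graded_mx (sum_deg e f) e (col_mx 1%:M 0 : 'M[S]_(p + q, p)).
    by apply: graded_col_mx; [apply: graded_mx1|apply: graded_mx0].
  apply: (reg_le_ext (graded_submod_ker gAB) gpr).
    apply: (@reg_le_inj k _ _ _ f _ (row_mx 0 1%:M)) kB => [|w _|x].
    - by apply: graded_row_mx; [apply: graded_mx0|apply: graded_mx1].
    - by rewrite mul_mx_row mulmx1 mulmx0 -row_mx0 => /eq_row_mx[].
    - rewrite -[x]hsubmxK !mul_row_col mulmx0 addr0 mulmx1 mulmxN.
      split=> [[]|[w wB]]; last first.
        rewrite mul_mx_row mulmx1 mulmx0 => /eq_row_mx[-> ->].
        by rewrite wB mul0mx subr0.
      move=> xB x0; move: xB; rewrite x0 mul0mx add0r => /eqP; rewrite oppr_eq0 => /eqP xB.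
      by exists (rsubmx x); rewrite // mul_mx_row mulmx1 mulmx0.
  apply: reg_le_eq (reg_le_free _ (fun i => r1 _ (er i))) => u; split=> // _.
  have [|w uA] := (AB (u *m A)).1; first by exists u.
  exists (row_mx u w); rewrite mul_row_col ?mulmxN ?uA ?subrr //.
  by rewrite mulmx1 mulmx0 addr0.
pose sigma : 'M[S]_(p + q, p) := col_mx 1%:M (- V).
have gsigma : graded_mx (sum_deg e f) e sigma.
  by apply: graded_col_mx; [apply: graded_mx1|apply: graded_mxN].
have: reg_le k (r + 1 + 1) (sum_deg e f) (fun x => P x /\ x *m sigma = 0).
  apply: (@reg_le_inj k _ _ _ f _ (row_mx V 1%:M) (fun=> True)).
  - by apply: graded_row_mx => //; apply: graded_mx1.
  - by move=> w _; rewrite mul_mx_row mulmx1 -row_mx0 => /eq_row_mx[].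
  - move=> x; rewrite /P -[x]hsubmxK !mul_row_col !mulmxN mulmx1.
    split=> [[_ /eqP]|[w _]].
      rewrite subr_eq0 => /eqP ->; exists (rsubmx x) => //.
      by rewrite mul_mx_row mulmx1.
    rewrite mul_mx_row mulmx1 => /eq_row_mx[-> ->].
    by rewrite -mulmxA VA !subrr.
  - by apply: reg_le_free => i; apply/(le_trans (fr i)); lia.
move=> /(reg_le_coker gsigma)/(_ kP); apply: reg_le_eq => u.
split=> [[x + ->]|uA]; last first.
  by exists (row_mx u 0); rewrite /P mul_row_col ?mul0mx ?addr0 // mulmx1.
rewrite /P -[x]hsubmxK !mul_row_col mulmx1 !mulmxN mulmxBl.
by rewrite -(mulmxA _ V) VA.
Qed.

(** Let [B] be generators of degree at most [r], and write [A = W B] and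
    [B = V A]. By minimality [W V] is the identity modulo the maximal ideal, so
    every row of [W] has an entry with a nonzero constant term; that entry has
    degree 0, so the generator of [A] has the degree of some generator of
    [B]. *)
Lemma minimal_gen_deg k r p m (e : 'I_p -> int) (d : 'I_m -> int) (A : 'M[S]_(p, m)) :
  graded_mx e d A -> (forall u : 'rV[S]_p, u *m A = 0 -> forall i, (u 0 i)@_0%MM = 0) ->
  reg_le k.+1 r d (fun v => exists u, v = u *m A) ->
  forall i, e i <= r.
Proof.
move=> gA minA [q [f [B [gB fr AB _]]]] i.
have gT : graded_submod f (fun=> True) by split.
have [l|W [gW _ WB]] := graded_lift gT gB gA.
  have [|w ->] := (AB (row l A)).1; last by exists w.
  by exists (delta_mx 0 l); rewrite -rowE.
have [V VA] : exists V : 'I_q -> 'rV[S]_p, forall j, row j B = V j *m A.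
  apply: (fin_all_exists (P := fun j (v : 'rV_p) => row j B = v *m A)) => j; apply/AB.
  by exists (delta_mx 0 j); rewrite -rowE.
have /minA/(_ i) : (delta_mx 0 i - row i W *m \matrix_j V j) *m A = 0.
  rewrite mulmxBl -rowE -mulmxA -row_mul.
  have -> : (\matrix_j V j) *m A = B.
    by apply/row_matrixP => j; rewrite row_mul rowK.
  by rewrite WB subrr.
move=> Wi; have [j Wij] : exists j, (W i j)@_0%MM != 0.
  apply/existsP; apply: contraT => /existsPn W0; move: Wi.
  rewrite !mxE mcoeffB !eqxx mcoeff1 eqxx raddf_sum big1 ?subr0 /=.
    by move/eqP; rewrite oner_eq0.
  move=> j _; rewrite !mxE [LHS]rmorphM.
  by have /negPn/eqP Wij := W0 j; rewrite [X in X * _]Wij mul0r.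
have := gW i j 0%MM; rewrite mcoeff_msupp mdeg0 => /(_ Wij) eq0.
by have := fr j; lia.
Qed.

Lemma minimal_resolution_deg (F : free_complex K n) (I : S -> Prop) r :
  minimal_graded_free_resolution F I ->
  (forall k, reg_le k r (fun _ : 'I_1 => 0) (fun v => I (v 0 0))) ->
  forall i (p : 'I_(free_rank F i)), gen_deg p <= r + i%:Z.
Proof.
case=> -[gaug gdiff] [augI augE diffE] minF regI.
have const0 i (u : 'rV[S]_(free_rank F i)) :
    (exists w, u = w *m diff F i) -> forall j, (u 0 j)@_0%MM = 0.
  move=> [w ->] j; rewrite mxE raddf_sum big1 //= => l _.
  by rewrite [LHS]rmorphM [X in _ * X]minF mulr0.
suff step i : (forall p : 'I_(free_rank F i), gen_deg p <= r + i%:Z) /\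
    forall k, reg_le k (r + i%:Z + 1) (@gen_deg _ _ F i)
      (fun v => exists w, v = w *m diff F i).
  by move=> i; case: (step i).
elim: i => [|i [_ IHk]].
  have g0 : graded_mx (@gen_deg _ _ F 0%N) (fun=> 0) (aug F).
    by move=> p j; rewrite ord1 subr0.
  have regA k : reg_le k r (fun=> 0) (fun v => exists u, v = u *m aug F).
    apply: reg_le_eq (regI k) => v; rewrite augI.
    by split=> -[u vu]; exists u; [apply/rowP => j; rewrite ord1 vu|rewrite vu].
  have deg0 : forall p : 'I_(free_rank F 0), gen_deg p <= r.
    by apply: (minimal_gen_deg g0) (regA 1%N) => u /augE; apply: const0.
  rewrite addr0; split=> // k.
  by apply: reg_le_eq (reg_le_syzygies g0 deg0 (regA k.+1)) => u.
have degS : forall p : 'I_(free_rank F i.+1), gen_deg p <= r + i%:Z + 1.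
  by apply: (minimal_gen_deg (gdiff i)) (IHk 1%N) => u /diffE; apply: const0.
have -> : r + i.+1%:Z = r + i%:Z + 1 by lia.
split=> // k.
by apply: reg_le_eq (reg_le_syzygies (gdiff i) degS (IHk k.+1)) => u; apply: diffE.
Qed.

End Regularity.

(** * Cover ideals as monomial ideals *)

Section CoverIdeal.
Variables (K : fieldType) (n : nat) (adj : rel 'I_n).
Hypotheses (adj_sym : symmetric adj) (adj_irr : irreflexive adj).
Local Notation S := {mpoly K[n]}.
Implicit Types (f g h : S) (m u : 'X_{1..n}) (W C : {set 'I_n}).

Lemma mem_msupp_mono_part (P : pred 'X_{1..n}) f m :
  (m \in msupp (mono_part P f)) = P m && (m \in msupp f).
Proof. by rewrite !mcoeff_msupp mcoeff_mono_part; case: (P m); rewrite ?eqxx. Qed.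

Lemma mono_part_split (P : pred 'X_{1..n}) f :
  f = mono_part P f + mono_part (predC P) f.
Proof.
apply/mpolyP => m; rewrite mcoeffD !mcoeff_mono_part /=.
by case: (P m); rewrite ?addr0 ?add0r.
Qed.

Lemma mpolyX_divides u f :
  {in msupp f, forall m, (u <= m)%MM} -> exists h, f = h * 'X_[u].
Proof.
move=> uf; exists (\sum_(m <- msupp f) f@_m *: 'X_[m - u]).
rewrite big_distrl {1}[f]mpolyE; apply: eq_big_seq => m /uf um /=.
by rewrite -scalerAl -mpolyXD submK.
Qed.

Lemma mem_msuppMX h u m :
  m \in msupp (h * 'X_[u]) -> exists2 m', m' \in msupp h & m = (m' + u)%MM.
Proof.
move=> /msuppM_le/allpairsP[[m1 m2] /= [m1h]].
by rewrite msuppX inE => /eqP -> ->; exists m1.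
Qed.

Lemma msuppMX_add h u m : ((m + u)%MM \in msupp (h * 'X_[u])) = (m \in msupp h).
Proof. by rewrite !mcoeff_msupp addmC mcoeffMX. Qed.

Lemma mpolyX_eq0F u : ('X_[u] == 0 :> S) = false.
Proof. by rewrite -msupp_eq0 msuppX. Qed.

Lemma in_degreeX u : in_degree (mdeg u) ('X_[u] : S).
Proof. by move=> m; rewrite msuppX inE => /eqP ->. Qed.

Definition covers W m : Prop :=
  forall i j, i \in W -> j \in W -> adj i j -> (m i != 0%N) || (m j != 0%N).

Definition cover_ideal_on W f : Prop := {in msupp f, forall m, covers W m}.

Lemma covers_addr W m m' : covers W m -> covers W (m + m')%MM.
Proof.
move=> cm i j Wi Wj ij; have := cm i j Wi Wj ij; rewrite !mnmDE !addn_eq0 !negb_and.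
by case/orP => ->; rewrite ?orbT.
Qed.

Lemma cover_ideal_onD W f g :
  cover_ideal_on W f -> cover_ideal_on W g -> cover_ideal_on W (f + g).
Proof.
by move=> Wf Wg m /msuppD_le; rewrite mem_cat => /orP[/Wf|/Wg].
Qed.

Lemma cover_ideal_onM W f g : cover_ideal_on W f -> cover_ideal_on W (g * f).
Proof.
move=> Wf m /msuppM_le/allpairsP[[m1 m2] /= [_ /Wf cm ->]].
by rewrite addmC; apply: covers_addr.
Qed.

Lemma cover_ideal_onN W f : cover_ideal_on W f -> cover_ideal_on W (- f).
Proof. by move=> Wf; rewrite -mulN1r; apply: cover_ideal_onM. Qed.

Lemma cover_ideal_on0 W : cover_ideal_on W 0.
Proof. by move=> m; rewrite msupp0. Qed.

Lemma cover_ideal_on_mono_part W P f :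
  cover_ideal_on W f -> cover_ideal_on W (mono_part P f).
Proof. by move=> Wf m; rewrite mem_msupp_mono_part => /andP[_ /Wf]. Qed.

(** A polynomial lies in [(x_i, x_j)] exactly when each of its monomials is
    divisible by [x_i] or by [x_j]. *)
Lemma cover_idealE f : cover_ideal adj f <-> cover_ideal_on setT f.
Proof.
split=> [If m fm i j _ _ /If[a [b fE]]|If i j ij].
  move: fm; rewrite fE => /msuppD_le; rewrite mem_cat.
  case/orP => /mem_msuppMX[m' _ ->]; rewrite !mnmDE !mnm1E eqxx addn1 //.
  by rewrite orbT.
pose P m := (m i != 0%N).
have [m|a fi] := @mpolyX_divides U_(i) (mono_part P f).
  by rewrite mem_msupp_mono_part lep1mP => /andP[].
have [m|b fj] := @mpolyX_divides U_(j) (mono_part (predC P) f).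
  rewrite mem_msupp_mono_part lep1mP => /andP[/= /negPn/eqP mi fm].
  by have := If m fm i j (in_setT i) (in_setT j) ij; rewrite mi eqxx.
by exists a, b; rewrite -fi -fj -mono_part_split.
Qed.

(** * The decomposition of a cover ideal at a vertex *)

Definition ideal_reg_le k r (I : S -> Prop) :=
  reg_le k r (fun _ : 'I_1 => 0) (fun v : 'rV[S]_1 => I (v 0 0)).

Definition nbhd_in W x : {set 'I_n} := [set y in W | adj x y].

Definition nbhd_mono W x : 'X_{1..n} :=
  [multinom (y \in nbhd_in W x : nat) | y < n].

Lemma mdeg_nbhd_mono W x : mdeg (nbhd_mono W x) = #|nbhd_in W x|.
Proof.
rewrite mdegE -sum1_card [RHS]big_mkcond /=; apply: eq_bigr => y _.
by rewrite mnmE; case: ifP.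
Qed.

Lemma nbhd_monoE W x y : y \in W -> adj x y -> nbhd_mono W x y = 1%N.
Proof. by move=> Wy xy; rewrite mnmE inE Wy xy. Qed.

(** A monomial covering the edges in [W] either involves [x], or involves all
    neighbours of [x]. *)
Lemma cover_ideal_on_decomp W x f : x \in W ->
  cover_ideal_on W f <->
  exists g h, [/\ cover_ideal_on (W :\ x) g,
    cover_ideal_on (W :\: closed_nbhd adj x) h
    & f = g * 'X_x + h * 'X_[nbhd_mono W x]].
Proof.
move=> Wx; split=> [If|[g [h [Ig Ih ->]]]].
  pose P m := (m x != 0%N).
  have [m|g fg] := @mpolyX_divides U_(x) (mono_part P f).
    by rewrite mem_msupp_mono_part lep1mP => /andP[].
  have [m|h fh] := @mpolyX_divides (nbhd_mono W x) (mono_part (predC P) f).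
    rewrite mem_msupp_mono_part => /andP[/= /negPn/eqP mx fm].
    apply/mnm_lepP => y; rewrite mnmE inE.
    case: (boolP (_ && _)) => //= /andP[Wy xy].
    by have := If m fm x y Wx Wy xy; rewrite mx eqxx lt0n.
  exists g, h; split; last by rewrite -fg -fh -mono_part_split.
  - move=> m; rewrite -(msuppMX_add _ U_(x)) -fg mem_msupp_mono_part => /andP[_ /If cm].
    move=> i j /setD1P[ix Wi] /setD1P[jx Wj] /(cm i j Wi Wj).
    by rewrite !mnmDE !mnm1E ![x == _]eq_sym (negbTE ix) (negbTE jx) !addn0.
  - move=> m; rewrite -(msuppMX_add _ (nbhd_mono W x)) -fh mem_msupp_mono_part.
    move=> /andP[_ /If cm] i j /setDP[Wi Ni] /setDP[Wj Nj] /(cm i j Wi Wj).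
    move: Ni Nj; rewrite !inE !negb_or !mnmDE !mnmE !inE.
    by move=> /andP[_ /negbTE ->] /andP[_ /negbTE ->]; rewrite !andbF !addn0.
apply: cover_ideal_onD => _ /mem_msuppMX[m fm ->] i j Wi Wj ij.
  rewrite !mnmDE !mnm1E; have [<-|xi] := eqVneq x i; first by rewrite addn1.
  have [<-|xj] := eqVneq x j; first by rewrite addn1 orbT.
  by rewrite !addn0; apply: (Ig m) => //; rewrite !inE eq_sym ?xi ?xj.
have [xi|xi] := boolP (adj x i); first by rewrite mnmDE nbhd_monoE // addn1.
have [xj|xj] := boolP (adj x j); first by rewrite !mnmDE (nbhd_monoE Wj) // addn1 orbT.
apply: (covers_addr _ (Ih m fm) _ _ ij); rewrite !inE negb_or ?xi ?xj ?Wi ?Wj !andbT.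
  by apply: contraNneq xj => <-.
by apply: contraNneq xi => <-; rewrite adj_sym.
Qed.

(** The relations are the Koszul relations of [x] and [x^N], which are coprime
    because [x] is not its own neighbour. *)
Lemma cover_ideal_on_kernel W x g h :
  cover_ideal_on (W :\: closed_nbhd adj x) h ->
  g * 'X_x + h * 'X_[nbhd_mono W x] = 0 <->
  exists2 a, cover_ideal_on (W :\: closed_nbhd adj x) a &
    g = a * 'X_[nbhd_mono W x] /\ h = - (a * 'X_x).
Proof.
move=> Ih; split=> [gh0|[a _ [-> ->]]]; last first.
  by rewrite mulNr mulrAC subrr.
have [m hm|b hb] := @mpolyX_divides U_(x) h.
  have: (m + nbhd_mono W x)%MM \in msupp (g * 'X_x).
    move/eqP: gh0; rewrite addr_eq0 => /eqP ->.
    by rewrite (perm_mem (msuppN _)) msuppMX_add.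
  move=> /mem_msuppMX[m' _ /mnmP/(_ x)]; rewrite lep1mP !mnmDE mnm1E eqxx mnmE inE.
  by rewrite adj_irr andbF addn0 addn1 => ->.
exists (- b); last first.
  split; last by rewrite mulNr opprK.
  have Xx0 : 'X_x != 0 :> S by rewrite mpolyX_eq0F.
  apply: (mulIf Xx0); apply/eqP; rewrite -subr_eq0 -gh0 hb; apply/eqP; ring.
apply: cover_ideal_onN => m bm i j Wi Wj ij.
have := Ih (m + U_(x))%MM; rewrite hb msuppMX_add => /(_ bm i j Wi Wj ij).
have neqx y : y \in W :\: closed_nbhd adj x -> (x == y) = false.
  by rewrite !inE negb_or eq_sym => /andP[/andP[/negbTE]].
by rewrite !mnmDE !mnm1E !neqx // !addn0.
Qed.

Lemma cover_ideal_on_sub_mul W x a :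
  cover_ideal_on (W :\: closed_nbhd adj x) a ->
  cover_ideal_on (W :\ x) (a * 'X_[nbhd_mono W x]).
Proof.
move=> Ia _ /mem_msuppMX[m am ->] i j /setD1P[ix Wi] /setD1P[jx Wj] ij.
have [xi|xi] := boolP (adj x i); first by rewrite mnmDE nbhd_monoE // addn1.
have [xj|xj] := boolP (adj x j); first by rewrite !mnmDE (nbhd_monoE Wj) // addn1 orbT.
by apply: (covers_addr _ (Ia m am) _ _ ij); rewrite !inE negb_or ?xi ?xj ?ix ?jx.
Qed.

Lemma lsubmx_homog_row p q (e : 'I_p -> int) (e' : 'I_q -> int) z (v : 'rV[S]_(p + q)) :
  lsubmx (homog_row (sum_deg e e') z v) = homog_row e z (lsubmx v).
Proof. by apply/rowP => j; rewrite !mxE /sum_deg (unsplitK (inl j)). Qed.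

Lemma rsubmx_homog_row p q (e : 'I_p -> int) (e' : 'I_q -> int) z (v : 'rV[S]_(p + q)) :
  rsubmx (homog_row (sum_deg e e') z v) = homog_row e' z (rsubmx v).
Proof. by apply/rowP => j; rewrite !mxE /sum_deg (unsplitK (inr j)). Qed.

(** This is the exact sequence attached to [x]. The middle term
    [J(G - x)(-1) (+) J(G - N[x])(-|N|)] is the module [M]; it maps onto
    [J(G)] by [phi], with kernel [J(G - N[x])(-|N| - 1)] embedded by [psi]. *)
Lemma ideal_reg_le_decomp k r W x : x \in W ->
  ideal_reg_le k (r - 1) (cover_ideal_on (W :\ x)) ->
  ideal_reg_le k (r - #|nbhd_in W x|%:Z) (cover_ideal_on (W :\: closed_nbhd adj x)) ->
  ideal_reg_le k r (cover_ideal_on W).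
Proof.
move=> Wx reg1 reg2; set a := #|_| in reg2.
set I1 := cover_ideal_on (W :\ x) in reg1.
set I2 := cover_ideal_on (W :\: _) in reg2.
pose u := nbhd_mono W x.
pose c z : 'I_1 -> int := fun=> 0 + z.
pose d : 'I_(1 + 1) -> int := sum_deg (c 1) (c a%:Z).
pose M (v : 'rV[S]_(1 + 1)) := I1 (lsubmx v 0 0) /\ I2 (rsubmx v 0 0).
have gM : graded_submod d M.
  split=> [|v w [v1 v2] [w1 w2]|b v [v1 v2]|z v [v1 v2]]; rewrite /M.
  - by rewrite !mxE; split; apply: cover_ideal_on0.
  - move: v1 v2 w1 w2; rewrite !mxE => v1 v2 w1 w2.
    by split; apply: cover_ideal_onD.
  - by move: v1 v2; rewrite !mxE => v1 v2; split; apply: cover_ideal_onM.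
  - rewrite lsubmx_homog_row rsubmx_homog_row mxE [in I2 _]mxE.
    by split; apply: cover_ideal_on_mono_part.
have regM : reg_le k r d M.
  have gpr : graded_mx d (c a%:Z) (col_mx 0 1%:M : 'M[S]_(1 + 1, 1)).
    by apply: graded_col_mx; [apply: graded_mx0|apply: graded_mx1].
  apply: (reg_le_ext gM gpr).
    apply: (@reg_le_inj _ _ k r _ _ (c 1) _ (row_mx 1%:M 0)) (reg_le_twist reg1).
    + by apply: graded_row_mx; [apply: graded_mx1|apply: graded_mx0].
    + by move=> v _; rewrite mul_mx_row mulmx1 mulmx0 -row_mx0 => /eq_row_mx[].
    + move=> v; rewrite /M -[v]hsubmxK mul_row_col row_mxKl row_mxKr.
      rewrite mulmx0 add0r mulmx1; split=> [[[v1 _] ->]|[w w1]].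
        by exists (lsubmx v) => //; rewrite mul_mx_row mulmx1 mulmx0.
      rewrite mul_mx_row mulmx1 mulmx0 => /eq_row_mx[-> ->].
      by split=> //; split=> //; rewrite mxE; apply: cover_ideal_on0.
  apply: reg_le_eq (reg_le_twist reg2) => v; split=> [v2|[w [_ w2] ->]].
    exists (row_mx 0 v); last by rewrite mul_row_col mulmx0 add0r mulmx1.
    by rewrite /M row_mxKl row_mxKr mxE; split=> //; apply: cover_ideal_on0.
  by rewrite -[w]hsubmxK mul_row_col mulmx0 add0r mulmx1.
pose phi : 'M[S]_(1 + 1, 1) := col_mx ('X_x)%:M ('X_[u])%:M.
have gscalar b b' z m : b - b' = (mdeg m)%:Z -> z = 'X_[m] \/ z = - 'X_[m] ->
    graded_mx (c b) (c b') (z%:M : 'M[S]_1).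
  move=> bb zE i j; rewrite !ord1 mxE eqxx mulr1n /c !add0r bb.
  by case: zE => ->; [|apply: in_degreeN]; apply: in_degreeX.
have gphi : graded_mx d (c 0) phi.
  apply: graded_col_mx.
    by apply: (gscalar _ _ _ U_(x)%MM); [rewrite mdeg1|left].
  by apply: (gscalar _ _ _ u); [rewrite mdeg_nbhd_mono subr0|left].
have phiE (v : 'rV[S]_(1 + 1)) :
    (v *m phi) 0 0 = lsubmx v 0 0 * 'X_x + rsubmx v 0 0 * 'X_[u].
  rewrite /phi -[v in LHS]hsubmxK mul_row_col !mul_mx_scalar mxE.
  by rewrite [X in X + _]mxE [X in _ + X]mxE; congr (_ + _); apply: mulrC.
have kphi : reg_le k (r + 1) d (fun v => M v /\ v *m phi = 0).
  have reg3 : reg_le k (r + 1 - (a%:Z + 1)) (fun=> 0) (fun v : 'rV_1 => I2 (v 0 0)).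
    by have -> : r + 1 - (a%:Z + 1) = r - a%:Z by ring.
  pose psi : 'M[S]_(1, 1 + 1) := row_mx ('X_[u])%:M (- 'X_x)%:M.
  have psiE (w : 'rV[S]_1) : w *m psi = row_mx ('X_[u] *: w) (- 'X_x *: w).
    by rewrite /psi mul_mx_row !mul_mx_scalar.
  apply: (@reg_le_inj _ _ k _ _ _ (c (a%:Z + 1)) _ psi) (reg_le_twist reg3).
  + apply: graded_row_mx.
      by apply: (gscalar _ _ _ u); [rewrite mdeg_nbhd_mono addrK|left].
    by apply: (gscalar _ _ _ U_(x)%MM); [rewrite mdeg1 addrAC subrr add0r|right].
  + move=> w _; rewrite psiE -row_mx0 => /eq_row_mx[+ _].
    move=> /rowP/(_ 0); rewrite !mxE => /eqP; rewrite mulf_eq0 mpolyX_eq0F /= => /eqP w0.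
    by apply/rowP => j; rewrite ord1 w0 mxE.
  + move=> v; split=> [[[v1 v2] v0]|[w w2 ->]].
      have := phiE v; rewrite v0 mxE => /esym.
      case/(cover_ideal_on_kernel _ v2) => b Ib [lv rv].
      exists (\row_j b); first by rewrite mxE.
      rewrite psiE -[v]hsubmxK; congr row_mx; apply/rowP => j.
        by rewrite (ord1 j) lv !mxE mulrC.
      by rewrite (ord1 j) rv !mxE mulNr mulrC.
    have I1w : I1 ('X_[u] * w 0 0) by rewrite mulrC; apply: cover_ideal_on_sub_mul.
    have I2w : I2 (- 'X_x * w 0 0) by apply: cover_ideal_onM.
    split; first by rewrite /M psiE row_mxKl row_mxKr !mxE.
    apply/rowP => j; rewrite ord1 phiE psiE row_mxKl row_mxKr !mxE; ring.
have := reg_le_coker gphi kphi regM; apply: reg_le_eq => v.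
rewrite (cover_ideal_on_decomp _ Wx); split=> [[w [w1 w2] ->]|[g [h [Ig Ih vE]]]].
  by exists (lsubmx w 0 0), (rsubmx w 0 0); split=> //; apply: phiE.
exists (row_mx (\row_j g) (\row_j h)).
  by rewrite /M row_mxKl row_mxKr !mxE.
by apply/rowP => j; rewrite ord1 phiE row_mxKl row_mxKr vE !mxE.
Qed.

(** * The star packing bound *)

(** Packings of the graph induced on [W], phrased by a common neighbour: in this
    form the property passes to smaller sets of vertices and of centers. *)
Definition packing_in W C : Prop :=
  forall c c' w, c \in C -> c' \in C -> w \in W ->
    w \in closed_nbhd adj c -> w \in closed_nbhd adj c' -> c = c'.

(** In the induction step the new vertex [x] is not a center: removing [x]
    keeps all centers, and removing [N[x]] loses at most one of them, because a
    center in [N[x]] has [x] in its closed neighbourhood. *)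
Lemma ideal_reg_le_packing k W C : C \subset W -> packing_in W C ->
  ideal_reg_le k (#|W|%:Z - #|C|%:Z) (cover_ideal_on W).
Proof.
have [N] := ubnP #|W|; elim: N W C => // N IHN W C; rewrite ltnS => WN CW packC.
have [WC|[x]] := set_0Vmem (W :\: C).
  have {WC} -> : W = C by apply/eqP; rewrite eqEsubset CW -setD_eq0 WC eqxx.
  rewrite subrr; apply: reg_le_eq (@reg_le_free K n k 0 1 (fun=> 0) (fun=> lexx 0)) => v.
  split=> // _ m _ i j Ci Cj ij; have ji : i = j.
    by apply: (packC _ _ j) => //; rewrite ?(subsetP CW) // inE ?ij ?eqxx ?orbT.
  by rewrite ji adj_irr in ij.
case/setDP => Wx Cx.
have cardW1 : #|W| = #|W :\ x|.+1 by rewrite (cardsD1 x W) Wx.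
have cardW2 : #|W| = (#|W :\: closed_nbhd adj x| + #|nbhd_in W x|).+1.
  rewrite cardW1 -(cardsID (nbhd_in W x) (W :\ x)) addnC; congr (_ + _).+1.
    apply: eq_card => y; rewrite !inE; case: eqP => //= _; first by rewrite andbF.
    by case: (y \in W); rewrite ?andbF ?andbT.
  apply: eq_card => y; rewrite !inE; case: eqP => [->|_] /=; last first.
    by case: (y \in W); rewrite ?andbF ?andbT.
  by rewrite adj_irr andbF.
have cardC : (#|C| <= #|C :\: closed_nbhd adj x|.+1)%N.
  rewrite -(cardsID (closed_nbhd adj x) C) -add1n leq_add2r.
  apply/card_le1_eqP => c c' /setIP[Cc xc] /setIP[Cc' xc'].
  apply: (packC _ _ x) => //; rewrite inE.
    by move: xc'; rewrite inE eq_sym adj_sym.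
  by move: xc; rewrite inE eq_sym adj_sym.
apply: (ideal_reg_le_decomp Wx).
  have -> : #|W|%:Z - #|C|%:Z - 1 = #|W :\ x|%:Z - #|C|%:Z by lia.
  apply: IHN; first by lia.
    by apply/subsetD1P.
  by move=> c c' w Cc Cc' /setD1P[_]; apply: packC.
apply: (@reg_le_mono _ _ _ (#|W :\: closed_nbhd adj x|%:Z - #|C :\: closed_nbhd adj x|%:Z)).
  by lia.
apply: IHN; first by lia.
  exact: setSD.
by move=> c c' w /setDP[Cc _] /setDP[Cc' _] /setDP[Ww _]; apply: packC.
Qed.

End CoverIdeal.

Theorem proposition1p1 (K : fieldType) (n : nat) (adj : rel 'I_n)
    (adj_sym : symmetric adj) (adj_irr : irreflexive adj)
    (r : int) (hr : is_regularity (@cover_ideal n adj K) r) :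
  r <= n%:Z - (star_packing_number adj)%:Z.
Proof.
have [C packC ->] : exists2 C, star_packing adj C & star_packing_number adj = #|C|.
  have [|C packC maxC] := @eq_bigmax_cond _ (star_packing adj) (fun C => #|C|).
    by apply/card_gt0P; exists set0; apply/forall_inP => x; rewrite inE.
  by exists C.
have packT : packing_in adj setT C.
  move=> c c' w Cc Cc' _ wc wc'; apply: contraTeq wc' => cc'.
  have /forall_inP/(_ c Cc)/forall_inP/(_ c' Cc')/implyP/(_ cc') := packC.
  by move=> /pred0P/(_ w)/=; rewrite wc /= => ->.
have [beta [[F [minF betaE]] [i [j [bij ->]]] _]] := hr.
have regJ k : reg_le k (n%:Z - #|C|%:Z) (fun _ : 'I_1 => 0)
    (fun v : 'rV[{mpoly K[n]}]_1 => cover_ideal adj (v 0 0)).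
  have := ideal_reg_le_packing K adj_sym adj_irr k (subsetT C) packT.
  rewrite cardsT card_ord; apply: reg_le_eq => v; symmetry; exact: cover_idealE.
move: bij; rewrite betaE /shift_multiplicity => /eqP; rewrite -lt0n.
move=> /card_gt0P[p]; rewrite inE => /eqP <-.
by rewrite lerBlDr; apply: (minimal_resolution_deg minF regJ).
Qed.
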